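(* Let $n$ and $l$ be positive integers, and let $A$ be an $l$-generated associative PI-algebra over a field satisfying an admissible polynomial identity of degree $n$. Then the essential height of $A$ over the set of words of length less than $n$ (in the generators) is less than $\Upsilon(n,l)$, where $$\Upsilon(n,l)=2\,n^{3\lceil\log_3 n\rceil+4}\,l.$$
   Context: A polynomial identity is called admissible if at least one of the coefficients of its terms of highest degree equals $1$. Words in $A$ are products of the fixed $l$ generators of $A$. $\lceil x\rceil$ denotes the least integer not smaller than $x$. An algebra $A$ has essential height $h=H_{Ess}(A)$ over a finite set $Y$ if $h$ is the least number for which one can choose a finite set $D\subset A$ such that $A$ is linearly spanned by elements of the form $t_1\cdot t_2\cdots t_m$ with $m\leqslant 2h+1$, where for each $i$ either $t_i\in D$ or $t_i=y_i^{k_i}$ with $y_i\in Y$, and the set of indices $i$ with $t_i\notin D$ has at most $h$ elements. *)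

(* Defs.v *)
From mathcomp Require Import all_boot all_order all_algebra.
From mathcomp Require Import finmap.
From mathcomp.multinomials Require Import monalg.

Set Implicit Arguments.
Unset Strict Implicit.
Unset Printing Implicit Defensive.

Import GRing.Theory.
Local Open Scope ring_scope.

(* Associative algebras over a field F, not necessarily unital (the ring
   structures of MathComp all have a unit): an F-vector space with an
   associative F-bilinear multiplication. *)
Definition assoc_algebra (F : fieldType) (A : lmodType F)
    (mul : A -> A -> A) : Prop :=
  [/\ associative mul,
      forall a : A, linear (mul a) &
      forall a : A, linear (mul^~ a)].

(* x_1 * ... * x_m; meaningful for m > 0 only, as there may be no unit. *)
Definition prods (V : nmodType) (mul : V -> V -> V) (s : seq V) : V :=
  if s is x :: s' then foldl mul x s' else 0.

Definition subalgebra (F : fieldType) (A : lmodType F) (mul : A -> A -> A)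
    (S : A -> Prop) : Prop :=
  [/\ S 0,
      forall (c : F) (x y : A), S x -> S y -> S (c *: x + y) &
      forall x y : A, S x -> S y -> S (mul x y)].

Definition generated_by (F : fieldType) (A : lmodType F) (mul : A -> A -> A)
    (X : A -> Prop) : Prop :=
  forall S : A -> Prop, subalgebra mul S -> (forall x, X x -> S x) ->
  forall a : A, S a.

(* A is generated by g_0, ..., g_(l-1), either as an algebra, or, when A has a
   unit e, as a unital algebra. *)
Definition l_generated (F : fieldType) (A : lmodType F) (mul : A -> A -> A)
    (l : nat) (g : 'I_l -> A) : Prop :=
  generated_by mul (fun x => exists i, x = g i) \/
  (exists2 e : A, left_id e mul /\ right_id e mul &
     generated_by mul (fun x => x = e \/ exists i, x = g i)).

(* Noncommutative polynomials in the variables x_0, x_1, ... are elements of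
   the monoid algebra of the free monoid {fmonom nat}.  Evaluation is the usual
   one for polynomials without constant term. *)
Definition ncpoly (F : fieldType) := {malg F[{fmonom nat}]}.

Definition nceval (F : fieldType) (A : lmodType F) (mul : A -> A -> A)
    (x : nat -> A) (f : ncpoly F) : A :=
  \sum_(w <- msupp f) f@_w *: prods mul [seq x i | i <- w].

Definition polynomial_identity (F : fieldType) (A : lmodType F)
    (mul : A -> A -> A) (f : ncpoly F) : Prop :=
  f@_mone = 0 /\ forall x : nat -> A, nceval mul x f = 0.

(* mmeasure fdeg f is the degree plus one, and is 0 when f = 0. *)
Definition has_degree (F : fieldType) (f : ncpoly F) (n : nat) : Prop :=
  mmeasure (@fdeg nat) f = n.+1.

Definition admissible (F : fieldType) (f : ncpoly F) : Prop :=
  exists2 w : {fmonom nat}, has_degree f (fdeg w) & f@_w = 1.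

(* The values in A of the nonempty words of length less than n. *)
Definition words_lt (F : fieldType) (A : lmodType F) (mul : A -> A -> A)
    (l : nat) (g : 'I_l -> A) (n : nat) : seq A :=
  [seq prods mul [seq g i | i <- val w]
     | k <- iota 1 n.-1, w <- enum {: k.-tuple 'I_l}].

Definition linearly_spanned_by (F : fieldType) (A : lmodType F)
    (P : A -> Prop) : Prop :=
  forall a : A, exists s : seq (F * A),
    (forall p, p \in s -> P p.2) /\ a = \sum_(p <- s) p.1 *: p.2.

Definition ess_product (F : fieldType) (A : lmodType F) (mul : A -> A -> A)
    (Y D : seq A) (h : nat) (a : A) : Prop :=
  exists t : seq A,
    [/\ (0 < size t <= 2 * h + 1)%N,
        forall x, x \in t ->
          x \in D \/
          exists y k, [/\ y \in Y, (0 < k)%N & x = prods mul (nseq k y)],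
        (count (fun x => x \notin D) t <= h)%N &
        a = prods mul t].

Definition ess_bound (F : fieldType) (A : lmodType F) (mul : A -> A -> A)
    (Y : seq A) (h : nat) : Prop :=
  exists D : seq A, linearly_spanned_by (ess_product mul Y D h).

Definition is_ess_height (F : fieldType) (A : lmodType F) (mul : A -> A -> A)
    (Y : seq A) (h : nat) : Prop :=
  ess_bound mul Y h /\ forall h' : nat, ess_bound mul Y h' -> (h <= h')%N.

(* up_log 3 n is the least e with n <= 3 ^ e, i.e. the ceiling of log_3 n. *)
Definition Upsilon (n l : nat) : nat :=
  (2 * n ^ (3 * up_log 3 n + 4) * l)%N.

(* Main.v *)
Require Import Defs.
From mathcomp Require Import all_boot all_order all_algebra.
From mathcomp Require Import finmap zify boolp.
From mathcomp.multinomials Require Import monalg.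

(** Let z_0, ..., z_(n-1) be elements of A.  Linearizing the identity in one
step gives z_0 ... z_(n-1) as a combination of the products of the z_i in the
other orders (linearize).  Hence a word that contains consecutive factors
u_0 > u_1 > ... > u_(n-1), each pair differing at a position inside both
factors, is a combination of lexicographically smaller words of the same
length, and A is spanned by the values of the words without such factors, the
nondivisible words (word_in_span), together with the unit if there is one.

A nondivisible word W cannot stay aperiodic for long.  If a block of fixed
length occurs n times in W, its factors at n different offsets can be picked
from successive occurrences in decreasing order; as W is nondivisible, two of
the factors coincide, and the block contains a long factor of period less than
n (periodic_in_block).  So W is a product of fragments, which are long factors
of periods k_i < n, maximal to the right, separated by words of bounded length
(fragmented_exists).  The latter, and the incomplete periods at the ends of
the fragments, go into the finite set D, and the essential height is at most
the number of fragments.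

The number of fragments is bounded as follows (few_fragments).  Let v_i be the
infinite periodic word that fragment i begins.  The pairs (i, s), standing for
v_i read from position s on, have no decreasing chain of length n along
nondecreasing i, for otherwise W would be divisible.  Colour such a pair by the
length of the longest chain that ends in it: there are n-1 colours, and inside
one colour the infinite words are nondecreasing in i.  Suppose the fragments
are labelled so that label and colour determine prefixes of length p.  The
prefix of length 3p of the pair (i, s) is determined by its label, its colour
and the colours of (i, s+p) and (i, s+2p); so for one label and one colour
there are at most (n-1)^2 of these prefixes, and they appear in increasing
order.  Splitting each label by the number of (colour, prefix) combinations
seen so far multiplies the number of labels by at most (n-1)^3 and replaces p
by 3p (refine_labels).  Prefixes of length 1 cost (n-1) l labels, and after
e = up_log 3 n further steps the prefixes determine periodic words of a given
period less than n.  A label, a period and a colour thus leave a single word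
v_i.  Finally, n fragments with the same word v_i, whose periodicity is broken
at the end each time by a larger letter, or each time by a smaller one, make W
divisible: the tails of the fragments compare according to the distance to the
break (same_word_divisible).  This gives at most
(n-1) l (n-1)^(3e) (n-1)^2 2 (n-1) fragments, not counting the last one, which
need not be broken.

Words are handled as functions from nat to nat restricted to an interval
[0, N); their letters are the numbers below l. *)

Set Implicit Arguments.
Unset Strict Implicit.
Unset Printing Implicit Defensive.

Import GRing.Theory.

(** * Lexicographic comparison and divisible words *)

Definition shift (x : nat -> nat) (s : nat) : nat -> nat := fun t => x (s + t).

Definition agree (d : nat) (x y : nat -> nat) : Prop :=
  forall t, t < d -> x t = y t.

(** The words x and y first differ at position d, where x is larger; a word is not
compared with its proper prefixes. *)
Definition lexgt_at (d : nat) (x y : nat -> nat) : Prop :=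
  agree d x y /\ y d < x d.

Lemma lex_trichotomy B x y :
  agree B x y \/ exists2 d, d < B & lexgt_at d x y \/ lexgt_at d y x.
Proof.
elim: B => [|B [IH|[d dB IH]]]; first by left.
- have [e|ne] := eqVneq (x B) (y B).
    left=> t; rewrite ltnS leq_eqVlt => /orP[/eqP->//|]; exact: IH.
  right; exists B => //; have [lt|lt] : x B < y B \/ y B < x B by lia.
    by right; split=> // t /IH.
  by left.
- by right; exists d => //; lia.
Qed.

Lemma lexgt_trans d1 d2 x y z :
  lexgt_at d1 x y -> lexgt_at d2 y z -> exists d, lexgt_at d x z.
Proof.
move=> [a1 g1] [a2 g2]; have [lt|gt|e] := ltngtP d1 d2.
- exists d1; split=> [t h|]; first by rewrite a1 // a2 //; lia.
  by rewrite -a2.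
- exists d2; split=> [t h|]; first by rewrite a1 // ?a2 //; lia.
  by rewrite a1.
- subst d2; exists d1; split=> [t h|]; first by rewrite a1 // a2.
  exact: ltn_trans g2 g1.
Qed.

(** The prefix of length B read as a number in base l, so that the lexicographic
order on words of one length becomes the order of the numbers. *)
Fixpoint code (l B : nat) (x : nat -> nat) : nat :=
  if B is B'.+1 then code l B' x * l + x B' else 0.

Lemma eq_code l B x y : agree B x y -> code l B x = code l B y.
Proof.
elim: B => //= B IH a; rewrite a // IH // => t h; apply: a; lia.
Qed.

Lemma code_lt l B x : (forall t, t < B -> x t < l) -> code l B x < l ^ B.
Proof.
elim: B => //= B IH h; rewrite expnSr.
have := IH (fun t ht => h t (ltnW ht)); have := h B (leqnn _); nia.
Qed.

Lemma code_lexgt l B d x y : (forall t, t < B -> y t < l) ->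
  d < B -> lexgt_at d x y -> code l B y < code l B x.
Proof.
move=> hy; elim: B hy => //= B IH hy dB xy.
have [e|ne] := eqVneq d B.
  by subst d; case: xy => a g; rewrite (eq_code l a) ltn_add2l.
have {}IH : code l B y < code l B x.
  by apply: IH => // [t h|]; [apply: hy; lia | lia].
have := hy B (leqnn _); nia.
Qed.

Lemma code_inj l B x y : (forall t, t < B -> x t < l) ->
  (forall t, t < B -> y t < l) -> code l B x = code l B y -> agree B x y.
Proof.
move=> hx hy e; case: (lex_trichotomy B x y) => // -[d dB []] h.
  by have := code_lexgt hy dB h; rewrite e ltnn.
by have := code_lexgt hx dB h; rewrite e ltnn.
Qed.

Lemma pigeonhole M m r (key : nat -> nat) :
  (forall i, i < M -> key i < m) -> m * r < M ->
  exists (f : nat -> nat) (c : nat),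
    (forall a, a <= r -> f a < M /\ key (f a) = c) /\
    (forall a b, a < b -> b <= r -> f a < f b).
Proof.
move=> hk hM.
pose s c := [seq i <- iota 0 M | key i == c].
have [c hc] : exists c, r < size (s c).
  apply: contrapT => /forallNP h.
  suff : M <= m * r by rewrite leqNgt hM.
  have -> : M = \sum_(c < m) size (s c).
    under eq_bigr do rewrite size_filter -sum1_count.
    rewrite (exchange_big_dep xpredT) //=.
    rewrite big_seq (eq_bigr (fun=> 1)) -?big_seq ?sum1_size ?size_iota //.
    move=> i; rewrite mem_iota add0n => /hk hi.
    rewrite (bigD1 (Ordinal hi)) //= big1 ?addn0 //.
    by move=> j /andP[/eqP e /eqP []]; apply/val_inj.
  rewrite -[X in _ <= X * _]card_ord -sum_nat_const leq_sum // => c _.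
  by have := h c; lia.
exists (nth 0 (s c)), c; split=> [a ha|a b ab br].
  have : nth 0 (s c) a \in s c by apply: mem_nth; exact: leq_ltn_trans ha hc.
  by rewrite mem_filter mem_iota => /andP[/eqP-> /andP[_ ?]].
have st : sorted ltn (s c) by apply: sorted_filter; [exact: ltn_trans|exact: iota_ltn_sorted].
apply: (sorted_ltn_nth ltn_trans 0 st) => //; rewrite inE.
  by apply: leq_ltn_trans hc; apply: ltnW; apply: leq_trans br.
exact: leq_ltn_trans hc.
Qed.

(** The i-th of n consecutive factors is x on [p i, p i.+1); the letters outside
[p 0, p n) play the part of a prefix and a suffix of the word. *)
Definition divisible (n : nat) (x : nat -> nat) (N : nat) : Prop :=
  exists p : nat -> nat,
    [/\ p n <= N, forall i, i < n -> p i < p i.+1 &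
     forall i j, i < j -> j < n -> exists d,
       [/\ p i + d < p i.+1, p j + d < p j.+1 &
           lexgt_at d (shift x (p i)) (shift x (p j))]].

(** Only the starting points of the factors matter when they are far apart
compared with the positions where the tails differ: the last factor is extended
to the end of the word. *)
Lemma divisible_gap n x N G (p : nat -> nat) :
  0 < G -> (forall i, i.+1 < n -> p i + G <= p i.+1) ->
  (forall i, i < n -> p i + G <= N) ->
  (forall i j, i < j -> j < n ->
     exists2 d, d < G & lexgt_at d (shift x (p i)) (shift x (p j))) ->
  divisible n x N.
Proof.
move=> G0 gap hN cmp; pose q i := if i < n then p i else N.
have qn : q n = N by rewrite /q ltnn.
have qi i : i < n -> q i = p i by rewrite /q => ->.
have qgap i : i < n -> q i + G <= q i.+1.
  move=> h; rewrite (qi i) // /q; case: ifP => h'; [exact: gap|exact: hN].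
exists q; split=> [|i h|i j ij jn]; first by rewrite qn.
  by have := qgap i h; lia.
have [d dG h] := cmp i j ij jn; exists d.
have iN : i < n by lia.
rewrite -(qi i) // -(qi j) // in h.
by split=> //; [have := qgap i iN | have := qgap j jn]; lia.
Qed.

Definition periodic_on (x : nat -> nat) (k s e : nat) : Prop :=
  forall t, s <= t -> t + k < e -> x t = x (t + k).

Lemma periodic_onM x k s e q t :
  periodic_on x k s e -> s <= t -> t + q * k < e -> x t = x (t + q * k).
Proof.
move=> per st; elim: q => [|q IH] h; first by rewrite addn0.
rewrite IH; last by lia.
by rewrite mulSn (addnC k) addnA; apply: per; lia.
Qed.

(** One more block than n.-1 times the number of words of length L + n forces a
block to occur n times. *)
Definition block_bound (n l L : nat) : nat :=
  (l ^ (L + n) * n.-1).+1 * (L + n).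

(** Some block of length L + n occurs n times.  If its factors of length L at two
offsets i < j < n coincide, then the block has period j - i on a long interval.
Otherwise these n factors can be sorted decreasingly, and taking the first from
the first occurrence, the second from the second one, and so on, shows that the
word is divisible. *)
Lemma periodic_in_block n l L x a N :
  1 < n -> 0 < L -> (forall t, x t < l) -> ~ divisible n x N ->
  a + block_bound n l L <= N ->
  exists s k, [/\ a <= s, s + L <= a + block_bound n l L, 0 < k < n &
                  periodic_on x k s (s + L)].
Proof.
move=> n1 L0 xl ndiv aN; set B := L + n.
set M := (l ^ B * n.-1).+1.
have KE : block_bound n l L = M * B by [].
pose key b := code l B (shift x (a + b * B)).
have keyl b : b < M -> key b < l ^ B.
  by move=> _; apply: code_lt => t _; apply: xl.
have [f [c [fc fi]]] := pigeonhole keyl (ltnSn _).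
have f0 : f 0 < M by case: (fc 0 (leq0n _)).
pose X b := a + f b * B.
have XE b t : b <= n.-1 -> t < B -> x (X b + t) = x (X 0 + t).
  move=> hb ht; have [_ h1] := fc _ hb; have [_ h0] := fc _ (leq0n n.-1).
  by have/(code_inj (fun t _ => xl _) (fun t _ => xl _))/(_ _ ht) := etrans h1 (esym h0).
apply: contrapT => noper.
(* the n factors of length L starting at the offsets i < n of the block are distinct *)
have dist i j : i < n -> j < n -> i <> j ->
    ~ agree L (shift x (X 0 + i)) (shift x (X 0 + j)).
  wlog ij : i j / i < j => [hw hi hj ne ag|hi hj _ ag].
    have [lt|lt] : i < j \/ j < i by lia.
      exact: (hw i j).
    by apply: (hw j i) => // [|t /ag//]; lia.
  apply: noper; exists (X 0 + i), (j - i); split; rewrite ?KE /X; try by lia.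
    by have : (f 0).+1 * B <= M * B; [rewrite leq_mul2r f0 orbT | rewrite /B; nia].
  move=> t h1 h2.
  rewrite -/(X 0) in h1 h2; set X0 := X 0 in ag h1 h2; clearbody X0.
  have tL : t - (X0 + i) < L by lia.
  have e1 : X0 + i + (t - (X0 + i)) = t by lia.
  have e2 : X0 + j + (t - (X0 + i)) = t + (j - i) by lia.
  by have := ag _ tL; rewrite /shift e1 e2.
apply: ndiv.
pose fac i := code l L (shift x (X 0 + i)).
pose o := sort (fun i j => fac j <= fac i) (iota 0 n).
have so : size o = n by rewrite size_sort size_iota.
have oi i : i < n -> nth 0 o i < n.
  move=> h; have : nth 0 o i \in o by rewrite mem_nth // so.
  by rewrite mem_sort mem_iota.
have uo : uniq o by rewrite sort_uniq iota_uniq.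
have sto : sorted (fun i j => fac j <= fac i) o.
  by apply: sort_sorted => i j; apply: leq_total.
apply: (@divisible_gap _ _ _ L (fun i => X i + nth 0 o i)) => // [i hi|i hi|i j ij jn].
- have := fi i i.+1 (ltnSn _) ltac:(lia); have := oi i ltac:(lia).
  rewrite /X => h1 h2; have : (f i).+1 * B <= f i.+1 * B by rewrite leq_mul2r h2 orbT.
  by rewrite /B; nia.
- have [h1 _] := fc i ltac:(lia); have := oi i hi; rewrite /X => h2.
  have : (f i).+1 * B <= M * B by rewrite leq_mul2r h1 orbT.
  by rewrite KE in aN; rewrite /B in aN *; nia.
- have in_ : i < n by lia.
  have hi := oi i in_; have hj := oi j jn.
  have ne : nth 0 o i <> nth 0 o j.
    by move/eqP; rewrite nth_uniq ?so //; lia.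
  have le : fac (nth 0 o j) <= fac (nth 0 o i).
    apply: (@sorted_ltn_nth _ (fun i j => fac j <= fac i) _ 0 o sto) => //;
      rewrite ?inE ?so // => u v w h1 h2; exact: leq_trans h2 h1.
  have [/(dist _ _ hi hj ne)//|[d dL]] :=
    lex_trichotomy L (shift x (X 0 + nth 0 o i)) (shift x (X 0 + nth 0 o j)).
  case=> h; last first.
    by have := code_lexgt (fun t _ => xl _) dL h; rewrite -/(fac _) -/(fac _); lia.
  have xE b t : b < n -> t < L -> x (X b + nth 0 o b + t) = x (X 0 + nth 0 o b + t).
    move=> hb ht; have hob := oi b hb; rewrite -(addnA (X b)) -(addnA (X 0)).
    by apply: XE; rewrite ?/B; lia.
  exists d => //; case: h => ag g; split=> [t td|]; rewrite /shift.
    have tL := ltn_trans td dL.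
    by rewrite (xE i) // (xE j) //; apply: ag.
  by rewrite (xE i) // (xE j).
Qed.

(** * Counting periodic fragments *)

Lemma mixed_radix_inj q i j a b :
  a < q -> b < q -> i * q + a = j * q + b -> i = j /\ a = b.
Proof.
move=> aq bq e; have q0 : 0 < q by apply: leq_ltn_trans aq.
have := congr1 (modn^~ q) e; rewrite /= !modnMDl !modn_small // => ab.
by move: e; rewrite ab => /addIn/eqP; rewrite eqn_pmul2r // => /eqP.
Qed.

Lemma mixed_radix_lt R q i a : i < R -> a < q -> i * q + a < R * q.
Proof. move=> iR aq; have : i.+1 * q <= R * q by rewrite leq_mul2r iR orbT.
by apply: leq_trans; rewrite mulSn addnC ltn_add2r. Qed.

Section Refinement.

Variables (M m : nat) (V : nat -> nat -> nat -> nat) (colour : nat -> nat -> nat).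
Hypothesis colour_lt : forall i s, i < M -> colour i s < m.
Hypothesis colour_mono : forall i j s t d, i <= j -> j < M ->
  colour i s = colour j t -> ~ lexgt_at d (V i s) (V j t).

(** The label is attached to the fragment, the colour to the pair (fragment, shift);
together they determine the first P letters. *)
Definition separates (P Q : nat) (lab : nat -> nat) : Prop :=
  (forall i, i < M -> lab i < Q) /\
  (forall i j s t, i < M -> j < M -> lab i = lab j -> colour i s = colour j t ->
     agree P (V i s) (V j t)).

(** The new label of i records, besides the old one, how many pairs (colour, key)
have occurred among the fragments up to i with the same old label; this number
lies between 1 and m * Q.  If it is the same for i <= j, then each pair that
occurs at j has occurred at some i' <= i.  Monotonicity inside the colour then
squeezes the prefix at i between those at i' and j, which are equal. *)
Lemma refine_labels P R Q (lab : nat -> nat) (key : nat -> nat -> nat) :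
  (forall i, i < M -> lab i < R) ->
  (forall i s, i < M -> key i s < Q) ->
  (forall i j s t, i < M -> j < M -> lab i = lab j -> colour i s = colour j t ->
     key i s = key j t -> agree P (V i s) (V j t)) ->
  exists lab', separates P (R * (m * Q)) lab'.
Proof.
move=> labR keyQ det.
pose S i := [set ck : 'I_m * 'I_Q | `[< exists j s, [/\ j <= i, lab j = lab i,
  colour j s = ck.1 & key j s = ck.2] >]].
have Smono i j : i <= j -> lab i = lab j -> S i \subset S j.
  move=> ij e; apply/subsetP=> ck; rewrite !inE => /asboolP[i' [s [h1 h2 h3 h4]]].
  by apply/asboolP; exists i', s; split=> //; [exact: leq_trans ij | rewrite h2].
have Spos i : i < M -> 0 < #|S i|.
  move=> iM; apply/card_gt0P.
  exists (Ordinal (colour_lt 0 iM), Ordinal (keyQ _ 0 iM)); rewrite inE.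
  by apply/asboolP; exists i, 0.
have Sle i : #|S i| <= m * Q.
  by apply: leq_trans (max_card _) _; rewrite card_prod !card_ord.
have Slt i : i < M -> #|S i|.-1 < m * Q by move=> /Spos; have := Sle i; lia.
exists (fun i => lab i * (m * Q) + #|S i|.-1); split.
  by move=> i iM; apply: mixed_radix_lt; [exact: labR | exact: Slt].
have main i j s t : i <= j -> i < M -> j < M -> lab i = lab j -> #|S i| = #|S j| ->
    colour i s = colour j t -> agree P (V i s) (V j t).
  move=> ij iM jM lab_ij card_ij col_ij.
  have eS : S i = S j by apply/eqP; rewrite eqEcard Smono //= card_ij.
  (* the key of (j, t) already occurs, in the same colour, at some (i', s') with i' <= i *)
  have : (Ordinal (colour_lt t jM), Ordinal (keyQ _ t jM)) \in S i.
    by rewrite eS inE; apply/asboolP; exists j, t.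
  rewrite inE => /asboolP[i' [s' /= [i'i lab_i' col_i' key_i']]].
  have i'M : i' < M by apply: leq_ltn_trans iM.
  have same : agree P (V i' s') (V j t).
    by apply: det => //; rewrite lab_i'.
  have [//|[d dP [gt|gt]]] := lex_trichotomy P (V i s) (V j t).
    by case: (colour_mono ij jM col_ij gt).
  case: (colour_mono (d := d) i'i iM (s := s') (t := s)); first by rewrite col_i'.
  case: gt => ag g; split=> [u ud|]; last by rewrite same.
  by rewrite same ?ag //; apply: ltn_trans dP.
move=> i j s t iM jM /mixed_radix_inj [||lab_ij card_ij]; try exact: Slt.
have {}card_ij : #|S i| = #|S j| by have := Spos i iM; have := Spos j jM; lia.
move=> col_ij; have [ij|/ltnW ji] := leqP i j; first exact: main.
by move=> u uP; rewrite (main j i t s).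
Qed.

End Refinement.

Section Fragments.

Variables (n l : nat) (x : nat -> nat) (N M : nat) (st en k : nat -> nat).

(** Two words with periods below n that differ do so among the first n * n letters. *)
Definition gap_size := n * n + 1.
(** Room for n starting points at distance gap_size, in every prescribed residue
modulo the period. *)
Definition frag_size := n * n * gap_size + n.

Hypothesis n1 : 1 < n.
Hypothesis x_lt : forall t, x t < l.
Hypothesis k_bound : forall i, i < M -> 0 < k i < n.
Hypothesis long : forall i, i < M -> st i + frag_size <= en i.
Hypothesis en_le : forall i, i < M -> en i <= N.
Hypothesis per : forall i, i < M -> periodic_on x (k i) (st i) (en i).
Hypothesis sep : forall i j, i < j -> j < M -> en i <= st j.
Hypothesis broken : forall i, i.+1 < M -> x (en i) <> x (en i - k i).
Hypothesis ndiv : ~ divisible n x N.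

Definition frag_word (i : nat) : nat -> nat := fun t => x (st i + t %% k i).
Definition frag_shift (i s : nat) : nat -> nat := shift (frag_word i) s.

Lemma frag_wordD i q t : frag_word i (t + q * k i) = frag_word i t.
Proof. by rewrite /frag_word (addnC t) modnMDl. Qed.

Lemma frag_wordE i t : i < M -> st i + t < en i -> x (st i + t) = frag_word i t.
Proof.
move=> iM h; rewrite /frag_word {1}(divn_eq t (k i)) (addnC (_ * _)) addnA.
rewrite -(periodic_onM (per iM)) ?leq_addr //.
by rewrite -addnA (addnC (_ %% _)) -divn_eq.
Qed.

Lemma frag_lexgt_bound i s j t d : i < M -> j < M ->
  lexgt_at d (frag_shift i s) (frag_shift j t) -> d < gap_size.
Proof.
move=> iM jM [ag g]; have /andP[ki0 kin] := k_bound iM; have /andP[kj0 kjn] := k_bound jM.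
have m0 : 0 < k i * k j by rewrite muln_gt0 ki0.
have [//|dG] := ltnP d gap_size.
have mG : k i * k j < gap_size.
  have : k i * k j <= n * n by apply: leq_mul; lia.
  by rewrite /gap_size; lia.
(* both words have period k i * k j, so d may be reduced modulo it *)
have rd : d %% (k i * k j) < d by apply: leq_trans (ltn_pmod _ m0) _; lia.
have := ag _ rd; rewrite /frag_shift /shift in g *.
have ei : frag_word i (s + d %% (k i * k j)) = frag_word i (s + d).
  rewrite -(frag_wordD i (d %/ (k i * k j) * k j)) -addnA; congr (frag_word _ (s + _)).
  by rewrite [RHS](divn_eq d (k i * k j)) addnC -mulnA (mulnC (k j)).
have ej : frag_word j (t + d %% (k i * k j)) = frag_word j (t + d).
  rewrite -(frag_wordD j (d %/ (k i * k j) * k i)) -addnA; congr (frag_word _ (t + _)).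
  by rewrite [RHS](divn_eq d (k i * k j)) addnC -mulnA.
by rewrite ei ej => e; rewrite e ltnn in g.
Qed.

(** A decreasing chain of r + 1 pairs (fragment, shift) with last member (i, s), in
which a fragment may be used several times. *)
Definition chain (r i s : nat) : Prop :=
  exists f : nat -> nat * nat,
    [/\ f r = (i, s), forall a, a <= r -> (f a).1 < M &
     forall a, a < r -> (f a).1 <= (f a.+1).1 /\
       exists d, lexgt_at d (frag_shift (f a).1 (f a).2)
                            (frag_shift (f a.+1).1 (f a.+1).2)].

Lemma chain0 i s : i < M -> chain 0 i s.
Proof. by move=> iM; exists (fun=> (i, s)); split. Qed.

Lemma chainS r i s j t d : chain r i s -> i <= j -> j < M ->
  lexgt_at d (frag_shift i s) (frag_shift j t) -> chain r.+1 j t.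
Proof.
move=> [f [fr fM fs]] ij jM h; exists (fun a => if a <= r then f a else (j, t)).
split=> [|a|a]; first by rewrite ltnn.
  by case: ifP => // /fM.
rewrite ltnS => ar; rewrite ar; case: ifP => [ar'|/negbT]; first exact: fs.
rewrite -leqNgt => ra; have {a ar ra} -> : a = r by lia.
by rewrite fr; split=> //; exists d.
Qed.

(** A shift of v_i occurs in fragment i at every position of the right residue
modulo k_i.  Placing the a-th member of the chain about a * gap_size periods
after the start of its fragment keeps consecutive members apart, even inside one
fragment. *)
Lemma no_chain i s : ~ chain n.-1 i s.
Proof.
move=> [f [_ fM fs]]; apply: ndiv.
have fM' a : a < n -> (f a).1 < M by move=> h; apply: fM; lia.
pose K a := k (f a).1.
have K0 a : a < n -> 0 < K a < n by move=> /fM' /k_bound.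
pose p a := st (f a).1 + ((f a).2 %% K a + a * gap_size * K a).
have pe a : a < n -> p a + gap_size <= en (f a).1.
  move=> an; have := long (fM' a an); have /andP[k0 kn] := K0 a an.
  have := ltn_pmod (f a).2 k0; rewrite /p /frag_size.
  have : a * gap_size * K a <= n.-1 * gap_size * n.
    by rewrite leq_mul // ?leq_mul //; lia.
  have -> : n * n * gap_size = n.-1 * gap_size * n + gap_size * n.
    by rewrite -mulnDl -mulSnr (ltn_predK n1) mulnAC.
  have : gap_size <= gap_size * n by rewrite leq_pmulr //; lia.
  move: (n.-1 * _ * n) (gap_size * n); lia.
apply: (@divisible_gap _ _ _ gap_size p); rewrite ?/gap_size ?addn1 //.
- move=> a an; have [le _] := fs a ltac:(lia).
  have [lt|ge] := ltnP (f a).1 (f a.+1).1.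
    have := pe a ltac:(lia); have := sep lt (fM' _ an).
    by rewrite /p -/gap_size /gap_size; lia.
  have e : (f a.+1).1 = (f a).1 by lia.
  have /andP[k0 kn] := K0 a ltac:(lia).
  have := ltn_pmod (f a).2 k0; rewrite /p /K e -/(K a) => h.
  by have := leq0n ((f a.+1).2 %% K a); rewrite /gap_size; nia.
- by move=> a an; have := pe a an; have := en_le (fM' a an); rewrite /gap_size; lia.
- move=> a b ab bn.
  have [d h] : exists d, lexgt_at d (frag_shift (f a).1 (f a).2)
                            (frag_shift (f b).1 (f b).2).
    elim: b ab bn => // b IH; rewrite ltnS leq_eqVlt => /orP[/eqP->|ab] bn.
      by case: (fs b); [lia|].
    have [d1 h1] := IH ab (ltnW bn); have [_ [d2 h2]] := fs b ltac:(lia).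
    exact: lexgt_trans h1 h2.
  have an := ltn_trans ab bn.
  have dG := frag_lexgt_bound (fM' _ an) (fM' _ bn) h.
  exists d; first by move: dG; rewrite /gap_size addn1.
  have pE c t : c < n -> t < gap_size -> x (p c + t) = frag_shift (f c).1 (f c).2 t.
    move=> cn tG; rewrite /p -addnA frag_wordE ?fM' //; last first.
      by have := pe c cn; rewrite /p; lia.
    rewrite /frag_shift /shift addnAC frag_wordD.
    by rewrite [in RHS](divn_eq (f c).2 (K c)) (addnC (_ * _)) addnAC frag_wordD.
  case: h => ag g; split=> [t td|].
    by rewrite /shift !pE //; [exact: ag | exact: ltn_trans dG..].
  by rewrite /shift !pE.
Qed.

(** The rank used in the proof of the dual Dilworth theorem. *)
Definition colour (i s : nat) : nat := \max_(r < n.-1 | `[< chain r i s >]) r.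

Lemma colour_lt i s : colour i s < n.-1.
Proof.
have : colour i s <= n.-2 by apply/bigmax_leqP => r _; have := ltn_ord r; lia.
by lia.
Qed.

Lemma chain_colour i s : i < M -> chain (colour i s) i s.
Proof.
move=> iM; apply: (big_ind (fun r => chain r i s)); first exact: chain0.
  by move=> r1 r2 c1 c2; rewrite /maxn; case: ifP.
by move=> r /asboolP.
Qed.

Lemma colour_mono i j s t d : i <= j -> j < M -> colour i s = colour j t ->
  ~ lexgt_at d (frag_shift i s) (frag_shift j t).
Proof.
move=> ij jM e h.
have c := chainS (chain_colour s (leq_ltn_trans ij jM)) ij jM h.
have [lt|ge] := ltnP (colour i s).+1 n.-1.
  have : (colour i s).+1 <= colour j t.
    by apply: (leq_bigmax_cond (Ordinal lt)); apply/asboolP.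
  by rewrite e ltnn.
apply: (@no_chain j t); rewrite (_ : n.-1 = (colour i s).+1) //.
by have := colour_lt i s; lia.
Qed.

(** For the first step the key of (i, s) is its first letter; for the passage from p to
3p it is the pair of colours of (i, s + p) and (i, s + 2p). *)
Lemma labels e : exists lab, separates M frag_shift colour (3 ^ e)
  (n.-1 * l * (n.-1 * (n.-1 * n.-1)) ^ e) lab.
Proof.
elim: e => [|e [lab [labR labP]]].
  rewrite expn0 muln1 -[n.-1 * l]mul1n.
  apply: (@refine_labels _ _ _ _ _ _ _ _ _ (fun=> 0) (fun i s => frag_shift i s 0)) => //.
  - by move=> i s _; exact: colour_lt.
  - exact: colour_mono.
  - by move=> i s _; exact: x_lt.
  - by move=> i j s t _ _ _ _ eq0 [].
rewrite expnSr [in _ ^ e.+1]expnSr mulnA; set p := 3 ^ e in labP *.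
apply: (@refine_labels _ _ _ _ _ _ _ _ _ lab
  (fun i s => colour i (s + p) * n.-1 + colour i (s + 2 * p))) => //.
- by move=> i s _; exact: colour_lt.
- exact: colour_mono.
- by move=> i s iM; apply: mixed_radix_lt; exact: colour_lt.
move=> i j s t iM jM lab_ij c0 /mixed_radix_inj[]; try exact: colour_lt.
move=> c1 c2 u up.
have sh i' s' q v : frag_shift i' (s' + q) v = frag_shift i' s' (q + v).
  by rewrite /frag_shift /shift addnA.
have [u1|u1] := ltnP u p; first exact: labP.
have [u2|u2] := ltnP u (2 * p).
  have := labP _ _ _ _ iM jM lab_ij c1 (u - p) ltac:(lia).
  by rewrite !sh subnKC.
have := labP _ _ _ _ iM jM lab_ij c2 (u - 2 * p) ltac:(lia).
by rewrite !sh subnKC.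
Qed.

(** The tail of a fragment that consists of its incomplete last period and of q
periods before it starts at the beginning of a period. *)
Lemma fragment_end i q : i < M ->
  let D := q * k i + (en i - st i) %% k i in D <= en i - st i ->
  agree D (shift x (en i - D)) (frag_word i) /\ x (en i - k i) = frag_word i D.
Proof.
move=> iM D De; have /andP[k0 kn] := k_bound iM; have lng := long iM.
have [q' eD] : exists q', en i - st i - D = q' * k i.
  exists ((en i - st i) %/ k i - q); rewrite mulnBl /D.
  by rewrite {1}(divn_eq (en i - st i) (k i)) subnDr.
have kG : k i <= frag_size by rewrite /frag_size; lia.
split=> [t tD|].
  rewrite /shift (_ : en i - D + t = st i + (t + q' * k i)); last by lia.
  by rewrite frag_wordE // ?frag_wordD //; lia.
rewrite (_ : en i - k i = st i + (en i - st i - k i)); last by lia.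
rewrite frag_wordE //; last by lia.
rewrite -(frag_wordD i 1) mul1n subnK; last by lia.
by rewrite -(frag_wordD i q' D) -eD subnKC.
Qed.

(** A tail that reaches the break after D letters follows the common periodic word
up to D and leaves it there upwards or downwards.  When all breaks go up, an
earlier break makes the tail larger, so the distances must increase from one
fragment to the next; when all go down, they must decrease. *)
Lemma same_word_divisible (f : nat -> nat) up :
  (forall a, a < n -> (f a).+1 < M) ->
  (forall a b, a < b -> b < n -> f a < f b) ->
  (forall a, a < n -> k (f a) = k (f 0)) ->
  (forall a, a < n -> frag_word (f a) =1 frag_word (f 0)) ->
  (forall a, a < n -> (x (en (f a) - k (f a)) < x (en (f a))) = up) ->
  False.
Proof.
move=> fM flt fk fw fup; apply: ndiv.
have fM' a : a < n -> f a < M by move=> /fM /ltnW.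
pose q a := if up then a else n.-1 - a.
pose D a := q a * k (f a) + (en (f a) - st (f a)) %% k (f a).
have kb a : a < n -> 0 < k (f a) < n by move=> /fM' /k_bound.
have DG a : a < n -> D a < gap_size.
  move=> an; have /andP[k0 kn] := kb a an.
  have := ltn_pmod (en (f a) - st (f a)) k0.
  have : q a * k (f a) <= n.-1 * n by apply: leq_mul (ltnW kn); rewrite /q; case: ifP; lia.
  by rewrite /D /gap_size; nia.
have G2 : 2 * gap_size <= frag_size.
  have : 2 * gap_size <= n * n * gap_size by rewrite leq_mul2r; nia.
  by rewrite /frag_size; lia.
have Dl a : a < n -> D a <= en (f a) - st (f a).
  by move=> an; have := DG a an; have := long (fM' a an); lia.
have end_ a : a < n -> agree (D a) (shift x (en (f a) - D a)) (frag_word (f 0)) /\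
    x (en (f a) - k (f a)) = frag_word (f 0) (D a).
  move=> an; have [h1 h2] := fragment_end (fM' a an) (Dl a an).
  by split=> [t /h1|]; rewrite -(fw a an).
apply: (@divisible_gap _ _ _ gap_size (fun a => en (f a) - D a)).
- by rewrite /gap_size addn1.
- move=> a an; have := DG _ an; have := Dl _ an; have := long (fM' _ an).
  by have := sep (flt a a.+1 (ltnSn _) an) (fM' _ an); lia.
- move=> a an; have := sep (ltnSn (f a)) (fM a an); have := long (fM a an).
  by have := en_le (fM a an); lia.
move=> a b ab bn; have an := ltn_trans ab bn.
have [ha ea] := end_ a an; have [hb eb] := end_ b bn.
have La := Dl a an; have Lb := Dl b bn.
have ka : k (f a) = k (f 0) by exact: fk.
have kk : k (f b) = k (f 0) by exact: fk.
have /andP[k0 _] := kb a an.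
have ra := ltn_pmod (en (f a) - st (f a)) k0.
have rb : (en (f b) - st (f b)) %% k (f b) < k (f b).
  by apply: ltn_pmod; rewrite kk -ka.
rewrite ka in ra k0; rewrite kk in rb.
have xe c : c < n -> D c <= en (f c) - st (f c) ->
    shift x (en (f c) - D c) (D c) = x (en (f c)).
  by move=> cn h; rewrite /shift subnK //; lia.
case: up fup @q @D DG Dl end_ ha ea hb eb La Lb xe => fup q D DG Dl _ ha ea hb eb La Lb xe.
  have DD : D a < D b.
    rewrite /D /q ka kk; have : a.+1 * k (f 0) <= b * k (f 0) by rewrite leq_mul2r ab orbT.
    by rewrite mulSn; lia.
  exists (D a); first exact: DG.
  split=> [t ta|]; first by rewrite ha // hb //; apply: ltn_trans DD.
  by rewrite hb // -ea xe // fup.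
have DD : D b < D a.
  rewrite /D /q ka kk.
  have : (n.-1 - b).+1 * k (f 0) <= (n.-1 - a) * k (f 0) by rewrite leq_mul2r; lia.
  by rewrite mulSn; lia.
exists (D b); first exact: DG.
split=> [t tb|]; first by rewrite hb // ha //; apply: ltn_trans DD.
rewrite ha // -eb xe //.
have := fup b bn; have := broken (fM b bn); lia.
Qed.

(** The key of a fragment consists of its label, its period, the colour of its
unshifted word and the direction of the break.  A key shared by n broken
fragments would make the word divisible, so each is used at most n - 1 times. *)
Theorem few_fragments e : n <= 3 ^ e -> M <= 2 * l * n.-1 ^ (3 * e + 4) + 1.
Proof.
move=> ne; have [lab [labR labP]] := labels e.
set m := n.-1 in labR *; set R := (_ * _ ^ e) in labR.
have RE : 2 * l * m ^ (3 * e + 4) = R * m * m * 2 * m.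
  rewrite /R (_ : m * (m * m) = m ^ 3) // -expnM expnD.
  by move: (m ^ (3 * e)) => E; rewrite /expn /=; nia.
rewrite RE leqNgt; apply/negP => lt.
pose up i := x (en i - k i) < x (en i).
pose key i := ((lab i * m + (k i).-1) * m + colour i 0) * 2 + up i.
have kb i : i < M -> (k i).-1 < m by move=> /k_bound; rewrite /m; lia.
have keyR i : i < M.-1 -> key i < R * m * m * 2.
  move=> iM; have {}iM : i < M by lia.
  apply: mixed_radix_lt; last by case: (up i).
  apply: mixed_radix_lt; last exact: colour_lt.
  by apply: mixed_radix_lt; [exact: labR | exact: kb].
have [|f [c [fc fi]]] := pigeonhole (r := m) keyR; first by lia.
have fM a : a < n -> (f a).+1 < M.
  by move=> an; case: (fc a); rewrite /m; lia.
have fM' a : a < n -> f a < M by move=> /fM /ltnW.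
have n0 : 0 < n by lia.
have same a : a < n ->
    [/\ lab (f a) = lab (f 0), k (f a) = k (f 0), colour (f a) 0 = colour (f 0) 0 &
        up (f a) = up (f 0)].
  move=> an; have [_] := fc a ltac:(rewrite /m; lia); have [_ <-] := fc 0 (leq0n _).
  have b2 (b : bool) : b < 2 by case: b.
  case/mixed_radix_inj => // + up_eq.
  case/mixed_radix_inj; rewrite ?colour_lt // => + col_eq.
  case/mixed_radix_inj; rewrite ?kb ?fM' // => lab_eq k_eq.
  split=> //; last by case: (up _) (up _) up_eq => [] [].
  by have := k_bound (fM' a an); have := k_bound (fM' 0 n0); lia.
apply: (@same_word_divisible f (up (f 0))) => // [a b ab bn|a an|a an t|a an].
- by apply: fi => //; rewrite /m; lia.
- by case: (same a an).
- have [lab_eq k_eq col_eq _] := same a an.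
  have := labP _ _ _ _ (fM' a an) (fM' 0 n0) lab_eq col_eq (t %% k (f 0)).
  rewrite /frag_shift /shift !add0n /frag_word k_eq modn_mod; apply.
  have /andP[k0 kn] := k_bound (fM' 0 n0).
  by apply: leq_trans (ltn_pmod _ k0) _; lia.
- by case: (same a an).
Qed.

End Fragments.

(** * Decomposition of nondivisible words into fragments *)

Section Decomposition.

Variables (n l : nat) (x : nat -> nat) (N L K : nat).

(** A decomposition of x on [a, N): each triple (s, e, k) is a fragment [s, e) of
period k, which cannot be prolonged to the right and starts at most K letters
after the end of the previous one. *)
Fixpoint fragmented (a : nat) (fs : seq (nat * nat * nat)) : Prop :=
  if fs is (s, e, k) :: fs' then
    [/\ a <= s <= a + K, s + L <= e <= N, 0 < k < n & periodic_on x k s e] /\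
    (e < N -> x e <> x (e - k)) /\ fragmented e fs'
  else N <= a + K.

Lemma maximal_period k s e : 0 < k -> s + k <= e -> e <= N -> periodic_on x k s e ->
  exists e', [/\ e <= e' <= N, periodic_on x k s e' & e' < N -> x e' <> x (e' - k)].
Proof.
move=> k0; move: {2}(N - e) (erefl (N - e)) => d.
elim: d e => [|d IH] e dE ske eN per.
  by exists e; split=> //; lia.
have [ext|brk] := eqVneq (x e) (x (e - k)); last first.
  by exists e; split=> [||_] //; [lia | apply/eqP].
have [|||t st te|e' [h1 h2 h3]] := IH e.+1; try lia.
  have [lt|ge] := ltnP (t + k) e; first exact: per.
  have -> : t + k = e by lia.
  by rewrite ext; congr x; lia.
by exists e'; split=> //; lia.
Qed.

Lemma fragmented_exists a : 1 < n -> n <= L -> (forall t, x t < l) ->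
  ~ divisible n x N -> K = block_bound n l L -> a <= N ->
  exists fs, fragmented a fs.
Proof.
move=> n1 nL xl ndiv KE; move: {2}(N - a) (leqnn (N - a)) => d.
elim: d a => [|d IH] a ad aN; first by exists [::] => /=; lia.
have [small|big] := leqP N (a + K); first by exists [::].
have L0 : 0 < L by lia.
have [|s [k [as_ sK kn per]]] := @periodic_in_block n l L x a N n1 L0 xl ndiv.
  by rewrite -KE ltnW.
rewrite -KE in sK.
have [k0 kL] : 0 < k /\ s + k <= s + L by lia.
have [|e [eN pere brk]] := maximal_period k0 kL _ per; first by lia.
have [||fs Hfs] := IH e; try lia.
by exists ((s, e, k) :: fs); split; [split=> //; lia | split].
Qed.

Lemma fragmented_nth a fs i : fragmented a fs -> i < size fs ->
  [/\ a <= (nth (0, 0, 0) fs i).1.1,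
      (nth (0, 0, 0) fs i).1.1 + L <= (nth (0, 0, 0) fs i).1.2 <= N,
      0 < (nth (0, 0, 0) fs i).2 < n,
      periodic_on x (nth (0, 0, 0) fs i).2 (nth (0, 0, 0) fs i).1.1
                    (nth (0, 0, 0) fs i).1.2 &
      (nth (0, 0, 0) fs i).1.2 < N ->
        x (nth (0, 0, 0) fs i).1.2 <>
        x ((nth (0, 0, 0) fs i).1.2 - (nth (0, 0, 0) fs i).2)].
Proof.
elim: fs a i => [|[[s e] k] fs IH] a [|i] //= [[h1 h2 h3 h4] [h5 h6]] hi.
  by split=> //; lia.
by have [? ? ? ? ?] := IH e i h6 hi; split=> //; lia.
Qed.

Lemma fragmented_sep a fs i j : fragmented a fs -> i < j -> j < size fs ->
  (nth (0, 0, 0) fs i).1.2 <= (nth (0, 0, 0) fs j).1.1.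
Proof.
elim: fs a i j => [|[[s e] k] fs IH] a [|i] [|j] //= [_ [_ h]] ij hj.
  by case: (fragmented_nth h hj).
exact: IH h _ _.
Qed.

Lemma fragmented_few a fs e : 1 < n -> L = frag_size n -> (forall t, x t < l) ->
  ~ divisible n x N -> n <= 3 ^ e -> fragmented a fs ->
  size fs <= 2 * l * n.-1 ^ (3 * e + 4) + 1.
Proof.
move=> n1 LE xl ndiv ne Hfs.
pose f i := nth (0, 0, 0) fs i.
have H i := @fragmented_nth a fs i Hfs.
have S i j := @fragmented_sep a fs i j Hfs.
apply: (few_fragments (x := x) (N := N) (st := fun i => (f i).1.1)
  (en := fun i => (f i).1.2) (k := fun i => (f i).2)) => // i iM.
- by have [_ _ ? _ _] := H i iM.
- by have [_ + _ _ _] := H i iM; rewrite LE => /andP[].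
- by have [_ /andP[]] := H i iM.
- by have [_ _ _ ? _] := H i iM.
- have [_ _ _ _ brk] := H i (ltnW iM); apply: brk.
  have := S i i.+1 (ltnSn _) iM; have [_ h _ _ _] := H i.+1 iM.
  have : 0 < L by rewrite LE /frag_size; lia.
  by move: h; rewrite /f; lia.
Qed.

End Decomposition.

Section Words.

Variable l : nat.
Hypothesis l0 : 0 < l.
Implicit Types w v : seq 'I_l.

Definition letters w : nat -> nat := nth 0 [seq val i | i <- w].

Lemma letters_lt w t : letters w t < l.
Proof.
rewrite /letters; have [h|h] := ltnP t (size w); last by rewrite nth_default ?size_map.
rewrite (nth_map (Ordinal l0)) //; exact: (ltn_ord (nth _ _ _)).
Qed.

Lemma letters_inj w v : size w = size v -> agree (size w) (letters w) (letters v) ->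
  w = v.
Proof.
move=> e ag; apply: (inj_map val_inj).
apply: (@eq_from_nth _ 0); rewrite !size_map // => t; exact: ag.
Qed.

Lemma letters_cat w v t :
  letters (w ++ v) t = if t < size w then letters w t else letters v (t - size w).
Proof. by rewrite /letters map_cat nth_cat size_map. Qed.

Definition factor w s d := take d (drop s w).

Lemma size_factor w s d : s + d <= size w -> size (factor w s d) = d.
Proof. by move=> h; rewrite size_takel // size_drop; lia. Qed.

Lemma letters_factor w s d t : t < d -> letters (factor w s d) t = letters w (s + t).
Proof. by move=> td; rewrite /letters map_take map_drop nth_take // nth_drop. Qed.

Lemma factorD w s d1 d2 : factor w s (d1 + d2) = factor w s d1 ++ factor w (s + d1) d2.
Proof. by rewrite /factor takeD drop_drop (addnC d1). Qed.

Lemma periodic_factor w k s e q : periodic_on (letters w) k s e ->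
  s + q * k <= e -> e <= size w ->
  factor w s (q * k) = flatten (nseq q (factor w s k)).
Proof.
move=> per + ew; elim: q => [|q IH] qe; first by rewrite mul0n /factor take0.
rewrite mulSnr factorD IH; last by move: qe; rewrite mulSnr; lia.
rewrite -addn1 nseqD flatten_cat /= cats0; congr (_ ++ _).
rewrite mulSnr in qe.
apply: letters_inj; rewrite !size_factor; try lia.
move=> t tk; rewrite !letters_factor // addnAC -(periodic_onM per) //; lia.
Qed.

(** Each fragment contributes the power formed by its complete periods; the remainder
of less than n letters joins the gap that follows.  This is why the factorization
starts at b, up to n letters before a. *)
Lemma fragmented_factorization n L K w a b fs :
  fragmented n (letters w) (size w) L K a fs ->
  n <= L -> b <= a -> a <= size w -> a <= b + n ->
  exists ts : seq (seq 'I_l),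
    [/\ flatten ts = drop b w, [::] \notin ts, size ts <= 2 * size fs + 1,
        count (fun u => K + n < size u) ts <= size fs &
        forall u, u \in ts -> size u <= K + n \/
          exists v q, [/\ 0 < size v < n, 0 < q & u = flatten (nseq q v)]].
Proof.
move=> + nL.
have glue c ts m : size c <= K + n ->
  [/\ [::] \notin ts, size ts <= m.*2, count (fun u => K + n < size u) ts <= m &
      forall u, u \in ts -> size u <= K + n \/
        exists v q, [/\ 0 < size v < n, 0 < q & u = flatten (nseq q v)]] ->
  exists ts', [/\ flatten ts' = c ++ flatten ts, [::] \notin ts', size ts' <= m.*2.+1,
      count (fun u => K + n < size u) ts' <= m &
      forall u, u \in ts' -> size u <= K + n \/
        exists v q, [/\ 0 < size v < n, 0 < q & u = flatten (nseq q v)]].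
  move=> hc [h1 h2 h3 h4].
  case: c hc => [|y c] hc; first by exists ts; split=> //; exact: leqW.
  exists ((y :: c) :: ts); split=> //=; first by rewrite ltnNge hc.
  by move=> u; rewrite inE => /orP[/eqP->|/h4]; [left|].
elim: fs a b => [|[[s e] k] fs IH] a b /=.
  move=> hN ba aw ab.
  have hc : size (drop b w) <= K + n by rewrite size_drop; lia.
  have [//|ts [h1 h2 h3 h4 h5]] := glue (drop b w) [::] 0 hc.
  by exists ts; split=> //; rewrite h1 cats0.
move=> [[sK eN kn per] [_ Hfs]] ba aw ab.
have /andP[k0 kn'] := kn.
set q := (e - s) %/ k.
have eq_ : e - s = q * k + (e - s) %% k by exact: divn_eq.
have rk := ltn_pmod (e - s) k0.
have q0 : 0 < q by rewrite divn_gt0 //; lia.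
have [|||ts [h1 h2 h3 h4 h5]] := IH e (s + q * k) Hfs; try lia.
have Psz : size (factor w s (q * k)) = q * k by rewrite size_factor //; lia.
have PE : factor w s (q * k) = flatten (nseq q (factor w s k)).
  by apply: periodic_factor per _ _; lia.
have kqk : k <= q * k by rewrite leq_pmull.
have [||ts' [g1 g2 g3 g4 g5]] := glue (factor w b (s - b)) (factor w s (q * k) :: ts) (size fs).+1.
- by rewrite size_factor; lia.
- split=> //=.
  + by rewrite inE negb_or h2 andbT eq_sym -size_eq0 Psz -lt0n (leq_trans k0).
  + by lia.
  + by case: (_ < _); lia.
  + move=> u; rewrite inE => /orP[/eqP->|/h5//]; right.
    by exists (factor w s k), q; split=> //; rewrite size_factor //; lia.
exists ts'; split=> //; last by rewrite addn1 mul2n.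
have fd s' d : factor w s' d ++ drop (s' + d) w = drop s' w.
  by rewrite addnC -drop_drop cat_take_drop.
have bs : b + (s - b) = s by lia.
by rewrite g1 /= h1 fd -{2}bs fd.
Qed.

End Words.

(** * Linear spans *)

Section Span.

Local Open Scope ring_scope.
Variables (F : fieldType).

Definition in_span (A : lmodType F) (P : A -> Prop) (a : A) : Prop :=
  exists s : seq (F * A), (forall p, p \in s -> P p.2) /\ a = \sum_(p <- s) p.1 *: p.2.

Variables (A B : lmodType F).
Implicit Types P Q : A -> Prop.

Lemma in_span0 P : in_span P 0.
Proof. by exists [::]; split=> //; rewrite big_nil. Qed.

Lemma in_span_gen P a : P a -> in_span P a.
Proof.
move=> Pa; exists [:: (1, a)]; split; last by rewrite big_seq1 scale1r.
by move=> p; rewrite inE => /eqP->.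
Qed.

Lemma in_spanD P a b : in_span P a -> in_span P b -> in_span P (a + b).
Proof.
move=> [s [hs ->]] [t [ht ->]]; exists (s ++ t); split; last by rewrite big_cat.
by move=> p; rewrite mem_cat => /orP[/hs|/ht].
Qed.

Lemma in_spanZ P c a : in_span P a -> in_span P (c *: a).
Proof.
move=> [s [hs ->]]; exists [seq (c * p.1, p.2) | p <- s]; split.
  by move=> p /mapP[q /hs hq ->].
by rewrite big_map scaler_sumr; apply: eq_bigr => p _; rewrite scalerA.
Qed.

Lemma in_spanN P a : in_span P a -> in_span P (- a).
Proof. by move=> /(in_spanZ (-1)); rewrite scaleN1r. Qed.

Lemma in_span_sum P (I : eqType) (r : seq I) (p : pred I) (E : I -> A) :
  (forall i, i \in r -> p i -> in_span P (E i)) -> in_span P (\sum_(i <- r | p i) E i).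
Proof.
move=> h; rewrite big_seq_cond; apply: big_ind; first exact: in_span0.
  by move=> a b; apply: in_spanD.
by move=> i /andP[]; apply: h.
Qed.

Lemma in_span_linear (f : A -> B) P (Q : B -> Prop) a : linear f ->
  (forall b, P b -> in_span Q (f b)) -> in_span P a -> in_span Q (f a).
Proof.
move=> fL h [s [hs ->]].
have f0 : f 0 = 0.
  by have := fL (-1) 0 0; rewrite scaleN1r oppr0 add0r scaleN1r addNr.
have -> : f (\sum_(p <- s) p.1 *: p.2) = \sum_(p <- s) p.1 *: f p.2.
  by elim: s {hs} => [|p s IH]; rewrite ?big_nil // !big_cons fL IH.
elim: s hs => [|p s IH] hs; first by rewrite big_nil; exists [::]; rewrite big_nil.
rewrite big_cons.
have [t [ht ->]] := h _ (hs p (mem_head _ _)).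
have [t' [ht' ->]] := IH (fun q hq => hs q (mem_behead (s := p :: s) hq)).
exists ([seq (p.1 * q.1, q.2) | q <- t] ++ t'); split.
  by move=> q; rewrite mem_cat => /orP[/mapP[q' /ht hq' ->]|/ht'].
rewrite big_cat big_map scaler_sumr /=; congr (_ + _).
by apply: eq_bigr => q _; rewrite scalerA.
Qed.

End Span.

Lemma in_span_trans (F : fieldType) (A : lmodType F) (P Q : A -> Prop) a :
  (forall b, P b -> in_span Q b) -> in_span P a -> in_span Q a.
Proof. by move=> h; apply: (in_span_linear (f := id)). Qed.

(** * Linearization of the identity *)

Section Algebra.

Local Open Scope ring_scope.
Variables (F : fieldType) (A : lmodType F) (mul : A -> A -> A).
Hypothesis algA : assoc_algebra mul.

Let mulA : associative mul. Proof. by case: algA. Qed.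
Let mul_linearr a : linear (mul a). Proof. by case: algA => _ h _; apply: h. Qed.
Let mul_linearl a : linear (mul^~ a). Proof. by case: algA => _ _ h; apply: h. Qed.

Lemma linear_sum (f : A -> A) (I : Type) (r : seq I) (p : pred I) (E : I -> A) :
  linear f -> f (\sum_(i <- r | p i) E i) = \sum_(i <- r | p i) f (E i).
Proof.
move=> fL; have f0 : f 0 = 0.
  by have := fL (-1) 0 0; rewrite scaleN1r oppr0 add0r scaleN1r addNr.
by apply: big_morph => // a b; rewrite -[a in LHS]scale1r fL scale1r.
Qed.

Lemma mul_sumr a (I : Type) (r : seq I) (p : pred I) (E : I -> A) :
  mul a (\sum_(i <- r | p i) E i) = \sum_(i <- r | p i) mul a (E i).
Proof. exact: linear_sum (@mul_linearr a). Qed.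

Lemma mul_suml a (I : Type) (r : seq I) (p : pred I) (E : I -> A) :
  mul (\sum_(i <- r | p i) E i) a = \sum_(i <- r | p i) mul (E i) a.
Proof. exact: linear_sum (@mul_linearl a). Qed.

Lemma mulr0 a : mul a 0 = 0.
Proof. by have := mul_sumr a [::] xpredT (fun _ : nat => 0); rewrite !big_nil. Qed.

Lemma mul0r a : mul 0 a = 0.
Proof. by have := mul_suml a [::] xpredT (fun _ : nat => 0); rewrite !big_nil. Qed.

Lemma prods_cat (s t : seq A) : s != [::] -> t != [::] ->
  prods mul (s ++ t) = mul (prods mul s) (prods mul t).
Proof.
case: s t => [|a s] [|b t] //= _ _; rewrite foldl_cat /=.
elim/last_ind: t => [|t c IH] //=.
by rewrite !foldl_rcons IH mulA.
Qed.

Lemma prods_cons a (s : seq A) : s != [::] -> prods mul (a :: s) = mul a (prods mul s).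
Proof. by move=> h; rewrite -cat1s prods_cat. Qed.

Lemma prods0 (s : seq A) : 0 \in s -> prods mul s = 0.
Proof.
elim: s => [//|a [|b s] IH]; first by rewrite inE => /eqP<-.
rewrite inE => /orP[/eqP<-|/IH e]; rewrite prods_cons //; first exact: mul0r.
by rewrite e mulr0.
Qed.

Lemma prods_prods (ss : seq (seq A)) : [::] \notin ss -> 
  prods mul [seq prods mul s | s <- ss] = prods mul (flatten ss).
Proof.
elim: ss => [//|s [|s' ss] IH]; first by rewrite /= cats0.
rewrite inE negb_or => /andP[s0 h]; rewrite [LHS]prods_cons // IH //.
rewrite eq_sym in s0; rewrite [flatten (s :: _)]/= (prods_cat s0) //.
by move: h; rewrite inE negb_or => /andP[]; case: (s').
Qed.

Section Linearization.

Variables (n : nat) (w0 : seq nat).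

(** The words obtained from w by replacing each letter j by a position where w0 has
letter j. *)
Fixpoint choices (w : seq nat) : seq (seq nat) :=
  if w is j :: w' then
    [seq p :: phi | p <- [seq p <- iota 0 n | nth 0 w0 p == j], phi <- choices w']
  else [:: [::]].

Lemma choices_cons j w : choices (j :: w) =
  [seq p :: phi | p <- [seq p <- iota 0 n | nth 0 w0 p == j], phi <- choices w].
Proof. by []. Qed.

Lemma mem_choices w phi :
  (phi \in choices w) = (all (fun p => p < n)%N phi && (map (nth 0 w0) phi == w)).
Proof.
elim: w phi => [|j w IH] phi; first by rewrite inE; case: phi => //= p phi; rewrite andbF.
apply/allpairsP/idP => [[[p psi] /= [hp hpsi ->]]|].
  move: hp hpsi; rewrite mem_filter mem_iota IH /= => /andP[/eqP-> ->] /andP[-> /eqP->].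
  by rewrite eqxx.
case: phi => [|p psi] //=.
rewrite eqseq_cons => /andP[/andP[pn hn] /andP[e he]].
by exists (p, psi); split=> //=; rewrite ?mem_filter ?mem_iota ?IH ?hn ?e.
Qed.

Lemma choices_uniq w : uniq (choices w).
Proof.
elim: w => //= j w IH; apply: allpairs_uniq => //; first by rewrite filter_uniq ?iota_uniq.
by move=> [p u] [q v] _ _ /= [-> ->].
Qed.

Lemma size_choices w phi : phi \in choices w -> size phi = size w.
Proof. by rewrite mem_choices => /andP[_ /eqP<-]; rewrite size_map. Qed.

Lemma prods_choices (z : nat -> A) w : w != [::] ->
  prods mul [seq \sum_(p <- iota 0 n | nth 0 w0 p == j) z p | j <- w] =
  \sum_(phi <- choices w) prods mul (map z phi).
Proof.
elim: w => [//|j [|j' w] IH] _.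
  rewrite choices_cons big_allpairs_dep big_filter.
  by apply: eq_bigr => p _; rewrite big_seq1.
rewrite prods_cons // IH //.
rewrite [choices [:: j, j' & w]]choices_cons [RHS]big_allpairs_dep [RHS]big_filter.
rewrite mul_suml; apply: eq_bigr => p _.
rewrite mul_sumr big_seq [RHS]big_seq.
apply: eq_bigr => phi hphi; rewrite [map z _]/= prods_cons //.
by have := size_choices hphi; case: (phi).
Qed.

End Linearization.

(** Let w0 be a term of degree n with coefficient 1.  Substitute for the variable
x_j the sum of the z_p over the positions p at which w0 has the letter j, and keep
the part of the identity in which all of z_0, ..., z_(n-1) occur.  Since no term
has degree above n, this part involves permutations only.  The identical
permutation arises from w0 alone, hence with coefficient 1. *)
Lemma linearize n (f : ncpoly F) : (0 < n)%N ->
  polynomial_identity mul f -> admissible f -> has_degree f n ->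
  forall z : nat -> A,
  in_span (fun a => exists phi : seq nat,
      [/\ perm_eq phi (iota 0 n), phi <> iota 0 n & a = prods mul (map z phi)])
    (prods mul (map z (iota 0 n))).
Proof.
move=> n0 [f0 fid] [w0 dw0 fw0] dn z.
have sw0 : size w0 = n.
  by move: dw0; rewrite /has_degree dn fdegE => -[].
have w0s : w0 \in msupp f by rewrite -mcoeff_neq0 fw0 oner_neq0.
have sw (w : {fmonom nat}) : w \in msupp f -> (size w <= n)%N /\ (w : seq nat) != [::].
  move=> h; split.
    by have : (fdeg w < mmeasure (@fdeg nat) f)%N := mmeasure_mnm_lt _ h; rewrite dn.
  apply/eqP => e; move: h; rewrite -mcoeff_neq0.
  have -> : w = mone by apply: fdeg_eq0I; rewrite fdegE e.
  by rewrite f0 eqxx.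
have kill (ps : seq nat) (y : nat -> A) :
  \sum_(w <- msupp f) f@_w *:
    (\sum_(phi <- choices n w0 w | all (mem phi) ps) prods mul (map y phi)) = 0.
  elim: ps y => [|p ps IH] y.
    rewrite -[RHS](fid (fun j => \sum_(p <- iota 0 n | nth 0 w0 p == j) y p)).
    rewrite /nceval big_seq [RHS]big_seq; apply: eq_bigr => w /sw[_ h].
    by rewrite prods_choices.
  (* subtracting the identity with z_p := 0 leaves the products in which z_p occurs *)
  pose y' q := if q == p then 0 else y q.
  have := congr2 (fun a b : A => a - b) (IH y) (IH y').
  rewrite subrr -sumrB => e; rewrite -[RHS]e; apply: eq_bigr => w _.
  rewrite -scalerBr; congr (_ *: _).
  rewrite [X in _ = X - _](bigID (fun phi : seq nat => p \in phi)) /=.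
  rewrite [X in _ = _ - X](bigID (fun phi : seq nat => p \in phi)) /=.
  rewrite [X in _ = _ - (X + _)]big1 ?add0r; last first.
    move=> phi /andP[_ h]; apply: prods0; apply/mapP; exists p => //.
    by rewrite /y' eqxx.
  rewrite [X in _ = _ - X](eq_bigr (fun phi => prods mul (map y phi))) ?addrK.
    by apply: eq_bigl => phi; rewrite andbC.
  move=> phi /andP[_ h]; congr (prods mul _); apply/eq_in_map => q hq.
  by rewrite /y'; case: eqP hq h => // -> ->.
have := kill (iota 0 n) z.
have permP (w : {fmonom nat}) phi : w \in msupp f -> phi \in choices n w0 w ->
    all (mem phi) (iota 0 n) -> perm_eq phi (iota 0 n).
  move=> hw hphi /allP sub.
  have sz : (size phi <= size (iota 0 n))%N.
    by rewrite size_iota (size_choices hphi); case: (sw w hw).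
  have [es em] := uniq_min_size (iota_uniq 0 n) sub sz.
  apply: uniq_perm (iota_uniq _ _) (fsym em).
  by rewrite -(eq_uniq es em) iota_uniq.
have id_in : iota 0 n \in choices n w0 w0.
  rewrite mem_choices; apply/andP; split.
    by apply/allP => p; rewrite mem_iota.
  by rewrite -sw0 -/(mkseq _ _) mkseq_nth.
rewrite (bigD1_seq w0) //= ?fset_uniq // fw0 scale1r -big_filter.
rewrite (bigD1_seq (iota 0 n)) /=; first last.
- by rewrite filter_uniq // choices_uniq.
- by rewrite mem_filter id_in andbT; apply/allP.
rewrite -addrA => /eqP; rewrite addr_eq0 => /eqP ->.
apply: in_spanN; apply: in_spanD.
  apply: in_span_sum => phi; rewrite mem_filter => /andP[h1 h2] /eqP h3.
  by apply: in_span_gen; exists phi; split=> //; exact: permP w0s h2 h1.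
apply: in_span_sum => w hw ww0; apply: in_spanZ.
apply: in_span_sum => phi h2 h1; apply: in_span_gen; exists phi; split=> //.
  exact: permP hw h2 h1.
move=> e; case/eqP: ww0; apply: val_inj => /=.
move: h2 id_in; rewrite e !mem_choices => /andP[_ /eqP e1] /andP[_ /eqP e2].
exact: etrans (esym e1) e2.
Qed.

(** * Reduction to nondivisible words *)

Section WordValues.

Variables (l : nat) (g : 'I_l -> A).
Hypothesis l0 : (0 < l)%N.
Implicit Type w : seq 'I_l.

Definition value (w : seq 'I_l) : A := prods mul (map g w).

Lemma value_cat (u v : seq 'I_l) : u != [::] -> v != [::] ->
  value (u ++ v) = mul (value u) (value v).
Proof. by case: u v => [|i u] [|j v] // _ _; rewrite /value map_cat prods_cat. Qed.

Lemma value_flatten ts : [::] \notin ts ->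
  value (flatten ts) = prods mul (map value ts).
Proof.
move=> h; rewrite /value map_flatten -prods_prods -?map_comp //.
by apply/mapP => -[[|i u] // hu]; rewrite hu in h.
Qed.

(** Multiplication one generator at a time, so that u and v may be empty although A
need not have a unit. *)
Definition sandwich (u v : seq 'I_l) (a : A) : A :=
  foldl (fun b i => mul b (g i)) (foldr (fun i b => mul (g i) b) a u) v.

Lemma sandwich_linear u v : linear (sandwich u v).
Proof.
move=> c a b; rewrite /sandwich.
have -> : foldr (fun i b => mul (g i) b) (c *: a + b) u =
   c *: foldr (fun i b => mul (g i) b) a u + foldr (fun i b => mul (g i) b) b u.
  by elim: u => //= i u ->; rewrite mul_linearr.
elim: v (foldr _ a u) (foldr _ b u) => //= i v IH a' b'.
by rewrite (mul_linearl (g i)) IH.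
Qed.

Lemma value_sandwich u w v : w != [::] -> value (u ++ w ++ v) = sandwich u v (value w).
Proof.
move=> w0; rewrite /sandwich.
have -> : foldr (fun i b => mul (g i) b) (value w) u = value (u ++ w).
  elim: u => //= i u ->; rewrite -[i :: _]cat1s (@value_cat [:: i]) //; case: (u) => //.
have : u ++ w != [::] by case: (u).
rewrite catA; case: (u ++ w) => [//|j s _].
elim/last_ind: v => [|v a IH]; first by rewrite cats0.
by rewrite foldl_rcons -cats1 catA value_cat // IH.
Qed.

Lemma flatten_factors w (p : nat -> nat) m :
  (forall i, (i < m)%N -> (p i < p i.+1)%N) ->
  flatten [seq factor w (p i) (p i.+1 - p i) | i <- iota 0 m] =
  factor w (p 0%N) (p m - p 0%N).
Proof.
elim: m => [|m IH] h; first by rewrite subnn /factor take0.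
have pm : (p 0 <= p m)%N.
  have : forall i, (i <= m)%N -> (p 0 <= p i)%N.
    by elim=> // i IHi hi; apply: leq_trans (IHi (ltnW hi)) _; apply/ltnW/h/ltnW.
  by apply.
have pS := h m (ltnSn _).
rewrite -addn1 iotaD map_cat flatten_cat IH /=; last by move=> i /ltnW; apply: h.
rewrite cats0 add0n addn1 (_ : p m.+1 - p 0%N = (p m - p 0%N) + (p m.+1 - p m))%N; last by lia.
by rewrite factorD subnKC.
Qed.

(** The smallest entry of s that phi moves is replaced in phi by one that comes later
in s. *)
Lemma first_difference (s phi : seq nat) : sorted ltn s -> perm_eq phi s -> phi <> s ->
  exists c i j r r', [/\ s = c ++ i :: r, phi = c ++ j :: r' & (i < j)%N].
Proof.
elim: s phi => [|i s IH] phi; first by move=> _ /perm_size /size0nil.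
case: phi => [|j phi] ss; first by move/perm_size.
have [->|ne] := eqVneq j i.
  rewrite perm_cons => hp he.
  have [|c [i' [j' [r [r' [-> -> lt]]]]]] := IH phi (path_sorted ss) hp.
    by move=> e; apply: he; rewrite e.
  by exists (i :: c), i', j', r, r'.
move=> hp _; exists [::], i, j, s, phi; split=> //.
have : j \in i :: s by rewrite -(perm_mem hp) mem_head.
rewrite inE (negbTE ne) /= => js.
by move: ss; rewrite /= path_sortedE; [move=> /andP[/allP/(_ _ js)] | exact: ltn_trans].
Qed.

(** The list es is empty, or consists of the unit when A is generated as a unital
algebra. *)
Lemma generators_span (es : seq A) :
  (forall x, x \in es -> left_id x mul /\ right_id x mul) ->
  generated_by mul (fun x => x \in es \/ exists i, x = g i) ->
  forall a, in_span (fun x => x \in es \/ exists2 w, w != [::] & x = value w) a.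
Proof.
set P := (fun x => x \in es \/ exists2 w, w != [::] & x = value w).
move=> id_es gen; apply: gen => [|x [xe|[i ->]]]; last 2 first.
- by apply: in_span_gen; left.
- by apply: in_span_gen; right; exists [:: i].
split; first exact: in_span0.
  by move=> c x y hx hy; apply: in_spanD hy; apply: in_spanZ.
move=> x y hx hy; apply: (in_span_linear (f := mul^~ y) (@mul_linearl y) _ hx) => b hb.
apply: (in_span_linear (f := mul b) (@mul_linearr b) _ hy) => c hc.
apply: in_span_gen; case: hb hc => [be|[u u0 ->]] [ce|[v v0 ->]].
- by have [-> _] := id_es b be; left.
- by have [-> _] := id_es b be; right; exists v.
- by have [_ ->] := id_es c ce; right; exists u.
- by right; exists (u ++ v); rewrite ?value_cat //; case: (u) u0.
Qed.

Variable n : nat.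

Definition nondivisible_value (a : A) : Prop :=
  exists w : seq 'I_l, [/\ w != [::], ~ divisible n (letters w) (size w) & a = value w].

Definition short_words (B : nat) : seq A :=
  [seq value (val t) | k <- iota 1 B, t <- enum {: k.-tuple 'I_l}].

Lemma mem_short_words B w : w != [::] -> (size w <= B)%N -> value w \in short_words B.
Proof.
move=> w0 wB; apply/allpairsPdep; exists (size w), (in_tuple w); split=> //.
  by rewrite mem_iota add1n ltnS wB lt0n size_eq0 w0.
by rewrite mem_enum.
Qed.

Lemma nondivisible_ess_product e a : (1 < n)%N -> (n <= 3 ^ e)%N ->
  nondivisible_value a -> forall es : seq A,
  ess_product mul (words_lt mul g n)
    (es ++ short_words (block_bound n l (frag_size n) + n))
    (2 * l * n.-1 ^ (3 * e + 4) + 1) a.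
Proof.
move=> n1 ne [w [w0 nd ->]] es.
set K := block_bound _ _ _; set h := (_ + 1)%N.
have nL : (n <= frag_size n)%N by rewrite /frag_size leq_addl.
have xl := letters_lt l0 w.
have [fs Hfs] := fragmented_exists n1 nL xl nd (erefl K) (leq0n (size w)).
have few : (size fs <= h)%N := fragmented_few n1 erefl xl nd ne Hfs.
have [ts [fl nil sz cnt pieces]] :=
  fragmented_factorization l0 Hfs nL (leqnn 0) (leq0n _) (leq0n _).
rewrite drop0 in fl.
exists (map value ts); split.
- rewrite size_map; apply/andP; split; last by lia.
  by case: (ts) fl w0 => // <-.
- move=> x /mapP[u hu ->]; case: (pieces u hu) => [small|[v [q [vn q0 uE]]]].
    left; rewrite mem_cat mem_short_words ?orbT //.
    by apply: contraNneq nil => <-.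
  right; exists (value v), q; split=> //.
    apply/allpairsPdep; exists (size v), (in_tuple v); split=> //; last by rewrite mem_enum.
    by rewrite mem_iota; lia.
  have v0 : v != [::] by rewrite -size_eq0 -lt0n; case/andP: vn.
  rewrite uE value_flatten ?map_nseq //.
  by rewrite mem_nseq eq_sym (negbTE v0) andbF.
- rewrite count_map; apply: leq_trans (leq_trans cnt few).
  have sub : {in ts, forall u, value u \notin es ++ short_words (K + n) ->
      (K + n < size u)%N}.
    move=> u hu; apply: contraNT; rewrite -leqNgt => small.
    rewrite mem_cat mem_short_words ?orbT //.
    by apply: contraNneq nil => <-.
  elim: (ts) sub => //= u ts' IH sub; apply: leq_add; last first.
    by apply: IH => v hv; apply: sub; rewrite inE hv orbT.
  by case: (value u \notin _) (sub u (mem_head _ _)) => // ->.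
- by rewrite -value_flatten // fl.
Qed.

Hypothesis n0 : (0 < n)%N.
Hypothesis permute : forall z : nat -> A,
  in_span (fun a => exists phi : seq nat,
      [/\ perm_eq phi (iota 0 n), phi <> iota 0 n & a = prods mul (map z phi)])
    (prods mul (map z (iota 0 n))).

(** At the first place where a permutation of the factors u_0, ..., u_(n-1) differs
from the identity, u_i is replaced by some u_j with j > i; the factor u_j is
smaller than u_i, and the difference lies inside both. *)
Lemma divisible_smaller w : divisible n (letters w) (size w) ->
  in_span (fun a => exists w', [/\ size w' = size w,
      (code l (size w) (letters w') < code l (size w) (letters w))%N & a = value w'])
    (value w).
Proof.
move=> [p [pN plt pdiff]].
pose u i := factor w (p i) (p i.+1 - p i).
have pSN i : (i < n)%N -> (p i.+1 <= size w)%N.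
  move=> hi; apply: leq_trans pN.
  have : forall m, (i.+1 + m <= n)%N -> (p i.+1 <= p (i.+1 + m))%N.
    elim=> [|m IH] hm; first by rewrite addn0.
    by rewrite addnS; apply: leq_trans (IH _) (ltnW (plt _ _)); lia.
  by move/(_ (n - i.+1)%N); rewrite subnKC //; apply.
have su i : (i < n)%N -> size (u i) = (p i.+1 - p i)%N.
  by move=> hi; rewrite size_factor //; have := pSN i hi; have := plt i hi; lia.
have un i : (i < n)%N -> u i != [::].
  by move=> hi; rewrite -size_eq0 su //; have := plt i hi; lia.
pose W phi := take (p 0%N) w ++ flatten (map u phi) ++ drop (p n) w.
have p0n : (p 0 <= p n)%N.
  have : forall i, (i <= n)%N -> (p 0 <= p i)%N.
    by elim=> // i IH hi; apply: leq_trans (IH (ltnW hi)) _; apply/ltnW/plt.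
  by apply.
have wE : w = W (iota 0 n).
  rewrite /W flatten_factors // -{1}(cat_take_drop (p 0%N) w); congr (_ ++ _).
  by rewrite -{1}(cat_take_drop (p n - p 0%N) (drop (p 0%N) w)) drop_drop subnK.
have perm_lt phi : perm_eq phi (iota 0 n) -> forall i, i \in phi -> (i < n)%N.
  by move=> hp i; rewrite (perm_mem hp) mem_iota.
have valW phi : perm_eq phi (iota 0 n) ->
    value (W phi) = sandwich (take (p 0%N) w) (drop (p n) w)
                             (prods mul (map (value \o u) phi)).
  move=> hp; have hnil : [::] \notin map u phi.
    by apply/mapP=> -[i /(perm_lt _ hp) /un /eqP hi /esym].
  rewrite /W value_sandwich; first by rewrite value_flatten // -map_comp.
  case: phi hp hnil => [hp|i phi _].
    by have := perm_size hp; rewrite size_iota => e; move: n0; rewrite -e.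
  by rewrite /= inE negb_or => /andP[]; case: (u i).
have -> : value w = sandwich (take (p 0%N) w) (drop (p n) w)
                             (prods mul (map (value \o u) (iota 0 n))).
  by rewrite {1}wE valW.
apply: in_span_linear (permute (value \o u)); first exact: sandwich_linear.
move=> _ [phi [hp hne ->]]; rewrite -valW //; apply: in_span_gen.
have sW : size (W phi) = size w.
  rewrite [in RHS]wE /W !size_cat; congr (_ + (_ + _))%N.
  by apply: perm_size; apply: perm_flatten; apply: perm_map.
exists (W phi); split=> //.
have [c [i [j [r [r' [e1 e2 ij]]]]]] := first_difference (iota_ltn_sorted 0 n) hp hne.
have jn : (j < n)%N by apply: (perm_lt _ hp); rewrite e2 mem_cat mem_head orbT.
have in_ := ltn_trans ij jn.
have [d [d1 d2 dl]] := pdiff i j ij jn.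
pose X := take (p 0%N) w ++ flatten (map u c).
have split_ q s : exists t, W (c ++ q :: s) = X ++ u q ++ t.
  exists (flatten (map u s) ++ drop (p n) w).
  by rewrite /W /X map_cat flatten_cat /= !catA.
have [t et] := split_ i r; have [t' et'] := split_ j r'.
rewrite -e1 -wE in et; rewrite -e2 in et'.
have let_u q v s : (q < n)%N -> (p q + s < p q.+1)%N ->
    letters (X ++ u q ++ v) (size X + s) = letters w (p q + s).
  move=> hq hs; rewrite !letters_cat ltnNge leq_addr /= addKn su // ifT; last by lia.
  by rewrite letters_factor //; lia.
have dS : (size X + d < size w)%N.
  by rewrite et !size_cat su //; have := plt i in_; lia.
apply: (@code_lexgt l (size w) (size X + d)) => //.
  by move=> s _; apply: letters_lt.
case: dl => ag gt; split=> [s sX|].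
  have [lt|ge] := ltnP s (size X); first by rewrite {1}et et' !letters_cat lt.
  have -> : s = (size X + (s - size X))%N by lia.
  rewrite {1}et et' !let_u //; try lia.
  by apply: (ag (s - size X)%N); lia.
by rewrite {1}et et' !let_u.
Qed.

Lemma word_in_span w : w != [::] -> in_span nondivisible_value (value w).
Proof.
move: {2}(code l (size w) (letters w)) (leqnn (code l (size w) (letters w))) => m.
elim: m w => [|m IH] w hm w0; have [div|nd] := pselect (divisible n (letters w) (size w));
  try by (apply: in_span_gen; exists w).
  apply: in_span_trans (divisible_smaller div) => b [w' [_ h _]].
  by move: (leq_trans h hm); rewrite ltn0.
apply: in_span_trans (divisible_smaller div) => b [w' [h1 h2 ->]].
apply: IH; first by rewrite h1 -ltnS; exact: leq_trans h2 hm.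
by rewrite -size_eq0 h1 size_eq0.
Qed.

End WordValues.

End Algebra.

(** * The essential height *)

Lemma bound_lt_Upsilon (n l : nat) : (0 < l)%N -> (1 < n)%N ->
  (2 * l * n.-1 ^ (3 * up_log 3 n + 4) + 1 < Upsilon n l)%N.
Proof.
move=> l0 n1; rewrite /Upsilon; set d := (3 * _ + 4)%N.
have : (n.-1 ^ d < n ^ d)%N by rewrite ltn_exp2r ?/d; lia.
by move: (n.-1 ^ d)%N (n ^ d)%N => a b ab; nia.
Qed.

Theorem mainTheorem7 :
  forall (n l : nat), (0 < n)%N -> (0 < l)%N ->
  forall (F : fieldType) (A : lmodType F) (mul : A -> A -> A),
  assoc_algebra mul ->
  forall g : 'I_l -> A, l_generated mul g ->
  (exists f : ncpoly F,
     [/\ polynomial_identity mul f, admissible f & has_degree f n]) ->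
  exists h : nat,
    is_ess_height mul (words_lt mul g n) h /\ (h < Upsilon n l)%N.
Proof.
move=> n l n0 l0 F A mul algA g gen [f [fid fadm fdeg]].
have permute := linearize algA n0 fid fadm fdeg.
suff [h hb hU] : exists2 h, ess_bound mul (words_lt mul g n) h & (h < Upsilon n l)%N.
  have ex : exists h', `[< ess_bound mul (words_lt mul g n) h' >] by exists h; apply/asboolP.
  exists (ex_minn ex); case: ex_minnP => m /asboolP hm mmin; split.
    by split=> // h' hh'; apply: mmin; apply/asboolP.
  by apply: leq_ltn_trans hU; apply: mmin; apply/asboolP.
(* for n = 1 there is no other order of the factors, so A is zero *)
have [n1|n1] := leqP n 1.
  have {n1} nE : n = 1%N by lia.
  subst n; exists 0%N; last by rewrite /Upsilon exp1n; lia.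
  exists [::] => a; apply: in_span_trans (permute (fun=> a)) => b [phi [hp hne _]].
  by case: hne; case: phi hp => [|i [|j phi]] /[dup] /perm_size //= _ /perm_mem /(_ 0%N);
     rewrite !inE eqxx => /eqP <-.
exists (2 * l * n.-1 ^ (3 * up_log 3 n + 4) + 1)%N; last exact: bound_lt_Upsilon.
have [es id_es gen_es] : exists2 es : seq A,
    forall x, x \in es -> left_id x mul /\ right_id x mul &
    generated_by mul (fun x => x \in es \/ exists i, x = g i).
  case: gen => [gen|[e he gen]].
    exists [::] => // S hS hg; apply: gen => // x hx; apply: hg; by right.
  exists [:: e] => [x|S hS hg]; first by rewrite inE => /eqP->.
  apply: gen => // x [->|hx]; apply: hg; [by left; rewrite inE | by right].
exists (es ++ short_words mul g (block_bound n l (frag_size n) + n)) => a.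
set P := ess_product _ _ _ _; suff : in_span P a by [].
apply: in_span_trans (generators_span algA id_es gen_es a) => b [be|[w w0 ->]].
  apply: in_span_gen; exists [:: b]; split=> //=.
  - by rewrite addn1.
  - by move=> x; rewrite inE => /eqP->; left; rewrite mem_cat be.
  - by rewrite mem_cat be.
apply: in_span_trans (word_in_span algA g l0 n0 permute w0) => c hc.
by apply: in_span_gen; apply: (nondivisible_ess_product algA l0 n1 _ hc es); exact: up_logP.
Qed.
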